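(* Let $k\geq 0$ and $t\geq 2$ be integers and let $T$ be a tournament with $n$ vertices and irregularity $i(T)\leq k$. If $n\geq 6t+5k-3$, then $\kappa_{w}^{*}(T)\geq t+1$; that is, $T$ is $\omega^{*}$-weakly connected for every $1\leq\omega\leq t+1$.
   Context: A tournament is a digraph in which each pair of distinct vertices is joined by exactly one arc. The irregularity $i(T)$ of a tournament $T$ is $\max_{x\in V(T)}|d^{+}(x)-d^{-}(x)|$, where $d^{+},d^{-}$ denote out- and in-degree. For distinct vertices $u,v$ of a digraph $D$, a weak $k^{*}$-container between $u$ and $v$ is a set of $k$ internally disjoint paths, each of which is either a $(u,v)$-path or a $(v,u)$-path (different paths may have different directions), whose union contains every vertex of $D$. $D$ is $k^{*}$-weakly connected if there is a weak $k^{*}$-container between every two distinct vertices of $D$. If $D$ is $1^{*}$-weakly connected, the weak spanning connectivity $\kappa_{w}^{*}(D)$ is the largest integer $k$ such that $D$ is $\omega^{*}$-weakly connected for all $1\leq\omega\leq k$. *)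

(* Defs.v *)
From mathcomp Require Import all_boot.
Set Implicit Arguments. Unset Strict Implicit. Unset Printing Implicit Defensive.

Definition is_tournament (T : finType) (D : rel T) : Prop :=
  (forall x, ~~ D x x) /\
  (forall x y, x != y -> (D x y || D y x) /\ ~~ (D x y && D y x)).

Definition outdeg (T : finType) (D : rel T) (x : T) : nat := #|[set y | D x y]|.
Definition indeg (T : finType) (D : rel T) (x : T) : nat := #|[set y | D y x]|.

Definition absdiff (a b : nat) : nat := (a - b) + (b - a).

Definition irregularity (T : finType) (D : rel T) : nat :=
  \max_(x : T) absdiff (outdeg D x) (indeg D x).

Definition is_dipath (T : finType) (D : rel T) (a b : T) (p : seq T) : Prop :=
  exists q : seq T, p = a :: q /\ path D a q /\ last a q = b /\ uniq p.

Definition internal (T : finType) (u v : T) (p : seq T) : seq T :=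
  [seq x <- p | (x != u) && (x != v)].

Definition weak_container (T : finType) (D : rel T) (k : nat) (u v : T)
    (P : seq (seq T)) : Prop :=
  [/\ size P = k,
      uniq P,
      forall p, p \in P -> is_dipath D u v p \/ is_dipath D v u p,
      forall i j, i < size P -> j < size P -> i != j ->
        forall x, x \in internal u v (nth [::] P i) ->
                  x \notin internal u v (nth [::] P j)
    & forall x : T, exists2 p, p \in P & x \in p].

Definition k_weakly_connected (T : finType) (D : rel T) (k : nat) : Prop :=
  forall u v : T, u != v -> exists P : seq (seq T), weak_container D k u v P.

(* Main.v *)
(* Fix u <> v and sort the other vertices into A (dominated by u and v), B (dominating both),
   C (u -> z -> v) and E (v -> z -> u). Vertices of C and E are interiors of paths of length 2, and an
   arc from A to B is the interior of a path of length 3 that may be run in either direction.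
   For w >= 2, take w disjoint short paths of this kind, at least one from u to v and one from v to u,
   and enlarge them greedily. A left-over vertex of C or E can be inserted in a path of the right
   direction; a left-over vertex of A (of B) that cannot be inserted is dominated by (dominates) all path
   vertices; an arc from a left-over a in A to a left-over b in B can be inserted as a pair. When nothing
   can be inserted, the left-over part of A has no arc leaving it, or that of B none entering it, which
   small irregularity forbids.
   For w = 1, T - {u, v} is strong, hence has a Hamiltonian cycle, and one looks for an arc of the cycle
   whose removal leaves the interior of a path between u and v. *)
Require Import Defs.
From mathcomp Require Import all_boot.
From mathcomp Require Import zify.
Set Implicit Arguments. Unset Strict Implicit. Unset Printing Implicit Defensive.

(** A bounded measure cannot increase forever, so this replaces the choice of an extremal object. It
    serves for maximal matchings, spanning linkages and Hamiltonian cycles. *)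
Lemma climb (A : Type) (f : A -> nat) (N : nat) (P Q : A -> Prop) :
  (forall a, P a -> f a <= N) ->
  (forall a, P a -> Q a \/ exists2 b, P b & f a < f b) ->
  forall a, P a -> exists2 b, P b & Q b.
Proof.
move=> fN step a; have [m] := ubnP (N - f a).
elim: m a => // m IH a le_m Pa.
have [Qa|[b Pb lt_ab]] := step a Pa; first by exists a.
by apply: IH (Pb); have := fN b Pb; lia.
Qed.

(** * Degrees in tournaments of small irregularity *)

Definition converse (T : Type) (D : rel T) : rel T := fun x y => D y x.

(** Out- and in-degree sum to [#|T| - 1], so a difference of at most [k] forces each to be at least
    half of [#|T| - 1 - k]. This form is linear and symmetric under [converse]. *)
Definition near_regular (T : finType) (k : nat) (D : rel T) : Prop :=
  is_tournament D /\
  forall x, #|T| <= 2 * outdeg D x + k + 1 /\ #|T| <= 2 * indeg D x + k + 1.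

Section Tournament.

Variables (T : finType) (D : rel T).
Hypothesis tD : is_tournament D.

Lemma tour_irr x : D x x = false.
Proof. by apply/negbTE; case: tD. Qed.

Lemma tourN x y : x != y -> D y x = ~~ D x y.
Proof. by case: tD => _ /[apply]; case: (D x y); case: (D y x) => - []. Qed.

Lemma tour_neq x y : D x y -> x != y.
Proof. by apply: contraTneq => ->; rewrite tour_irr. Qed.

Lemma tour_asym x y : D x y -> D y x = false.
Proof. by move=> xy; rewrite tourN ?xy // (tour_neq xy). Qed.

Lemma tour_converse : is_tournament (converse D).
Proof.
split=> [x|x y]; first by rewrite /converse tour_irr.
by rewrite eq_sym /converse => /(proj2 tD).
Qed.

Lemma outdeg_indeg x : outdeg D x + indeg D x = #|T|.-1.
Proof.
rewrite -(cardsC1 x) -[RHS](cardsID [set y | D x y]); congr (_ + _); apply: eq_card => y.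
  by rewrite !inE; case xy: (D x y); rewrite ?andbF // eq_sym (tour_neq xy).
rewrite !inE; case: eqVneq => [->|nyx]; first by rewrite tour_irr.
by rewrite (tourN nyx) negbK andbT.
Qed.

Lemma irregularity_near_regular k : irregularity D <= k -> near_regular k D.
Proof.
move=> irr; split=> // x; have := outdeg_indeg x.
have: absdiff (outdeg D x) (indeg D x) <= k.
  by apply: leq_trans irr; rewrite /irregularity (bigD1 x) //= leq_maxl.
have: 0 < #|T| by apply/card_gt0P; exists x.
by rewrite /absdiff; lia.
Qed.

(** The arcs inside [S] are counted once by tails and once by heads, so the average out-degree
    inside [S] is half of [#|S| - 1]. *)
Lemma ex_small_outdegree (S : {set T}) : S != set0 ->
  exists2 x, x \in S & 2 * #|[set y in S | D x y]| < #|S|.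
Proof.
move=> S0; apply/exists_inP; apply: contraT => /exists_inPn big.
have cardE e x : #|[set y in S | e x y]| = \sum_(y in S) e x y.
  rewrite -sum1_card [RHS]big_mkcond [LHS]big_mkcond; apply: eq_bigr => y _.
  by rewrite inE; case: (y \in S); case: (e x y).
have swap : \sum_(x in S) \sum_(y in S) D x y = \sum_(x in S) \sum_(y in S) D y x.
  by rewrite exchange_big.
have deg x : x \in S -> (\sum_(y in S) D x y + \sum_(y in S) D y x).+1 = #|S|.
  move=> xS; rewrite -big_split (bigD1 x) //= !tour_irr addnn add0n.
  rewrite (eq_bigr (fun=> 1)) => [|y /andP[_ nyx]].
    by rewrite sum1dep_card [RHS](cardsD1 x) xS; congr _.+1; apply: eq_card => y; rewrite !inE andbC.
  by rewrite (tourN nyx); case: (D y x).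
have: \sum_(x in S) #|S| <= \sum_(x in S) (\sum_(y in S) D x y + \sum_(y in S) D x y).
  by apply: leq_sum => x xS; have := big x xS; rewrite -leqNgt cardE; lia.
have: \sum_(x in S) #|S| = \sum_(x in S) (\sum_(y in S) D x y + \sum_(y in S) D y x) + \sum_(x in S) 1.
  by rewrite -big_split; apply: eq_bigr => x xS; rewrite -(deg x xS) /= addn1.
rewrite !big_split /= -swap sum1_card => ->.
by move: S0; rewrite -card_gt0; lia.
Qed.

End Tournament.

Lemma near_regular_converse (T : finType) k (D : rel T) :
  near_regular k D -> near_regular k (converse D).
Proof.
case=> tD deg; split=> [|x]; first exact: tour_converse.
by have [] := deg x.
Qed.

(** A vertex of [S] with fewer than [#|S| / 2] out-neighbours in [S] finds all its others in [W];
    this is compared with the lower bound on its out-degree. It is the only way in which separators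
    are bounded below. *)
Lemma out_closed_bound (T : finType) k (D : rel T) (S W : {set T}) :
  near_regular k D -> S != set0 ->
  (forall x y, x \in S -> D x y -> y \in S :|: W) ->
  #|T| <= #|S| + 2 * #|W| + k.
Proof.
case=> tD deg S0 cl; have [x xS small] := ex_small_outdegree tD S0.
have [out_x _] := deg x.
have: outdeg D x <= #|[set y in S | D x y]| + #|W|.
  apply: leq_trans (leq_card_setU _ _); apply: subset_leq_card.
  by apply/subsetP=> y; rewrite !inE => xy; have := cl x y xS xy; rewrite inE xy andbT.
by lia.
Qed.

Lemma in_closed_bound (T : finType) k (D : rel T) (S W : {set T}) :
  near_regular k D -> S != set0 ->
  (forall x y, x \in S -> D y x -> y \in S :|: W) ->
  #|T| <= #|S| + 2 * #|W| + k.
Proof. by move/near_regular_converse; apply: out_closed_bound. Qed.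

(** * Inserting a vertex into a path *)

Section Insertion.

Variables (T : finType) (D : rel T).
Hypothesis tD : is_tournament D.

(** The place is just before the first vertex after [a] that [x] dominates: its predecessor
    dominates [x]. *)
Lemma path_insert_head a b p x : x \notin a :: rcons p b ->
  path D a (rcons p b) -> D a x -> has (D x) (rcons p b) ->
  exists2 p', perm_eq p' (x :: p) & path D a (rcons p' b).
Proof.
elim: p a => [|c p IH] a /=.
  by rewrite orbF => _ _ ax xb; exists [:: x]; rewrite //= ax xb.
rewrite !inE !negb_or => /and3P[_ xc xp] /andP[ac cp] ax.
case: (boolP (D x c)) => [xc' _|xc' /= hx].
  by exists (x :: c :: p); rewrite //= ax xc' cp.
have cx : D c x by rewrite (tourN tD xc).
have [|p' pp' pth] := IH c _ cp cx hx; first by rewrite inE negb_or xc.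
exists (c :: p'); last by rewrite /= ac.
by rewrite -(perm_cons c) in pp'; apply: perm_trans pp' _; apply/permP => z /=; lia.
Qed.

(** Walk to the first vertex that dominates [x]; from there on [path_insert_head] applies, because
    [x] dominates the end [b]. *)
Lemma path_insert_last a b p x : x \notin a :: rcons p b ->
  path D a (rcons p b) -> D x b -> has (converse D x) (a :: p) ->
  exists2 p', perm_eq p' (x :: p) & path D a (rcons p' b).
Proof.
elim: p a => [|c p IH] a nx pth xb.
  by rewrite /= orbF => ax; exists [:: x]; rewrite //= [D a x]ax xb.
case: (boolP (D a x)) => [ax _|nax].
  by apply: path_insert_head => //; apply/hasP; exists b; rewrite // mem_rcons inE eqxx.
rewrite [has _ _]/= {1}/converse (negbTE nax) => hx.
move: pth nx => /= /andP[ac cp]; rewrite inE negb_or => /andP[_ nx].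
have [p' pp' pth] := IH c nx cp xb hx.
exists (c :: p'); last by rewrite /= ac.
by rewrite -(perm_cons c) in pp'; apply: perm_trans pp' _; apply/permP => z /=; lia.
Qed.

End Insertion.

(** * Disjoint strands and the weak containers that they form *)

Section Linkage.

Variables (T : finType) (D : rel T) (u v : T).

Definition tip (d : bool) : T := if d then u else v.

(* A strand [(d, p)] has the nonempty interior [p] and runs from [u] to [v] if [d], from [v] to [u] otherwise. *)
Definition strand (s : bool * seq T) : bool :=
  (s.2 != [::]) && path D (tip s.1) (rcons s.2 (tip (~~ s.1))).

Definition inner (L : seq (bool * seq T)) : seq T := flatten (map snd L).

Definition linkage (L : seq (bool * seq T)) : bool :=
  all strand L && uniq (u :: v :: inner L).

Lemma perm_inner L L' : perm_eq L L' -> perm_eq (inner L) (inner L').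
Proof. by move=> LL'; apply/perm_flatten/perm_map. Qed.

Lemma perm_linkage L L' : perm_eq L L' -> linkage L = linkage L'.
Proof.
move=> LL'; rewrite /linkage (perm_all _ LL'); congr (_ && _).
by apply: perm_uniq; rewrite !perm_cons perm_inner.
Qed.

Lemma inner_cat L L' : inner (L ++ L') = inner L ++ inner L'.
Proof. by rewrite /inner map_cat flatten_cat. Qed.

Lemma linkage_catl L L' : linkage (L ++ L') -> linkage L.
Proof.
rewrite /linkage all_cat inner_cat => /andP[/andP[-> _]].
by rewrite -[X in uniq X -> _]/((u :: v :: inner L) ++ inner L') cat_uniq => /andP[->].
Qed.

(** One strand absorbs the new vertices [xs]. The number of strands and the directions that occur do
    not change, so the operation can be iterated. *)
Lemma linkage_replace L d p xs p' : linkage L -> (d, p) \in L ->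
  uniq (xs ++ u :: v :: inner L) -> perm_eq p' (xs ++ p) ->
  path D (tip d) (rcons p' (tip (~~ d))) ->
  exists L', [/\ linkage L', size L' = size L, map fst L' =i map fst L
               & perm_eq (inner L') (xs ++ inner L)].
Proof.
move=> linkL dpL uniq_xs pp' pth; have LL' := perm_to_rem dpL.
set r := rem (d, p) L in LL'; exists ((d, p') :: r).
have perm_in : perm_eq (inner ((d, p') :: r)) (xs ++ inner L).
  move: (perm_inner LL'); rewrite -(perm_cat2l xs) perm_sym => /(perm_trans _); apply.
  by rewrite /inner /= catA perm_cat2r.
split=> //.
- move: linkL; rewrite (perm_linkage LL') /linkage /= => /andP[/andP[sp ->]].
  move=> _; rewrite {1}/strand pth /= andbT; apply/andP; split.
    rewrite -size_eq0 (perm_size pp') size_cat addn_eq0.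
    by case/andP: sp; rewrite -size_eq0 => /negbTE ->; rewrite andbF.
  rewrite -[X in is_true X]/(uniq (u :: v :: inner ((d, p') :: r))).
  rewrite -(perm_uniq (s1 := xs ++ u :: v :: inner L)) //.
  rewrite -cat1s -[u :: v :: _]cat1s perm_catCA perm_cat2l.
  by rewrite -cat1s -[v :: inner (_ :: _)]cat1s perm_catCA perm_cat2l perm_sym.
- by rewrite (perm_size LL').
by move=> b; rewrite (perm_mem (perm_map fst LL')).
Qed.

(** One strand of each direction is moved to the front before the list is cut, hence [2 <= w]. *)
Lemma linkage_trim L w : linkage L -> (forall d, d \in map fst L) ->
  2 <= w <= size L ->
  exists L', [/\ linkage L', size L' = w & forall d, d \in map fst L'].
Proof.
move=> linkL both /andP[w2 wL].
have /mapP[[d p] dpL /= dT] := both true; have /mapP[[d' p'] dpL' /= dF] := both false.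
subst d d'; have LL' := perm_to_rem dpL.
move: dpL'; rewrite (perm_mem LL') inE xpair_eqE /= => /perm_to_rem.
set r := rem (false, p') _; rewrite -(perm_cons (true, p)) => /(perm_trans LL') {}LL'.
exists ((true, p) :: (false, p') :: take w.-2 r); split.
- move: linkL; rewrite (perm_linkage LL') -{1}(cat_take_drop w.-2 r).
  exact: (@linkage_catl ((true, p) :: (false, p') :: take w.-2 r) (drop w.-2 r)).
- by move: wL; rewrite (perm_size LL') /= size_take; case: ltnP; lia.
by case; rewrite !inE.
Qed.

Lemma flatten_disjoint (ss : seq (seq T)) i j x : uniq (flatten ss) -> i < j ->
  x \in nth [::] ss i -> x \notin nth [::] ss j.
Proof.
elim: ss i j => [|s ss IH] [|i] [|j] //=; rewrite cat_uniq => /and3P[_ dis uss]; last by rewrite ltnS; exact: IH.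
move=> _ xs; have [js|js] := ltnP j (size ss); last by rewrite nth_default.
apply: contra dis => xj; apply/hasP; exists x => //.
by apply/flattenP; exists (nth [::] ss j); rewrite ?mem_nth.
Qed.

(** Empty entries could repeat without harming [uniq (flatten ss)]. This is why strands have
    nonempty interiors. *)
Lemma uniq_of_flatten (ss : seq (seq T)) :
  uniq (flatten ss) -> [::] \notin ss -> uniq ss.
Proof.
elim: ss => //= s ss IH; rewrite cat_uniq inE negb_or => /and3P[_ dis uss] /andP[s0 nss].
rewrite IH // andbT; apply: contra dis => sss; case: s s0 sss => // x s _ sss.
apply/hasP; exists x; last by rewrite inE eqxx.
by apply/flattenP; exists (x :: s); rewrite ?inE ?eqxx.
Qed.

Definition strand_path (s : bool * seq T) : seq T :=
  tip s.1 :: rcons s.2 (tip (~~ s.1)).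

(** Stripping [u] and [v] from the paths gives back the interiors of the strands, so disjointness
    and distinctness are read off from [inner L]. A first strand must exist to cover [u] and [v]. *)
Lemma linkage_container L : L != [::] -> linkage L ->
  (forall x, x \in u :: v :: inner L) ->
  weak_container D (size L) u v (map strand_path L).
Proof.
move=> L0 /andP[/allP strL uL] cover.
have uI : uniq (inner L) by case/and3P: uL.
have nin s x : s \in L -> x \in s.2 -> (x != u) && (x != v).
  move=> sL xs; have xI : x \in inner L by apply/flattenP; exists s.2; rewrite ?map_f.
  move: uL => /=; rewrite inE negb_or => /and3P[/andP[_ nu] nv _].
  by apply/andP; split; [apply: contraNneq nu => <- | apply: contraNneq nv => <-].
have intE s : s \in L -> internal u v (strand_path s) = s.2.
  move=> sL; rewrite /internal /strand_path /= -cats1 filter_cat /= (_ : filter _ s.2 = s.2).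
    by case: (s.1); rewrite /= !eqxx ?andbF ?cats0.
  by apply/all_filterP/allP => x; apply: nin.
have mapI : map (internal u v) (map strand_path L) = map snd L.
  by rewrite -map_comp; apply/eq_in_map => s /intE.
have nthI i : i < size L -> internal u v (nth [::] (map strand_path L) i) = nth [::] (map snd L) i.
  by move=> iL; rewrite -mapI (nth_map [::]) ?size_map.
split; rewrite ?size_map //.
- apply: (@map_uniq _ _ (internal u v)); rewrite mapI; apply: uniq_of_flatten => //.
  by apply/mapP=> -[s /strL /andP[s0 _] /esym/eqP]; rewrite (negbTE s0).
- move=> p /mapP[s sL ->]; have /andP[_ pth] := strL s sL.
  have us : uniq (strand_path s).
    rewrite /strand_path /= rcons_uniq mem_rcons inE negb_or.
    have usnd : uniq s.2.
      move: uI; rewrite /inner; case/path.splitPr: (map_f snd sL) => ss1 ss2.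
      by rewrite flatten_cat /= !cat_uniq; case/and3P=> _ _ /andP[].
    rewrite usnd andbT -andbA; have /andP[/= + _] := uL; rewrite inE negb_or => /andP[uv _].
    have nu : u \notin s.2 by apply/negP=> /(nin _ _ sL); rewrite eqxx.
    have nv : v \notin s.2 by apply/negP=> /(nin _ _ sL); rewrite eqxx andbF.
    by case: (s.1); rewrite /= nu nv ?andbT // eq_sym.
  move: us pth; rewrite /strand_path; case: (s.1) => us pth; [left | right];
    by eexists; split; first reflexivity; rewrite pth last_rcons.
- move=> i j iL jL nij x; rewrite !nthI //.
  case: (ltngtP i j) nij => // [ij _|ji _]; first exact: flatten_disjoint.
  by move=> xi; apply/negP=> /(flatten_disjoint uI ji); rewrite xi.
move=> x; case: L L0 cover {strL uL uI nin intE mapI nthI} => // s0 L _ /(_ x).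
rewrite !inE => /or3P[/eqP ->|/eqP ->|].
- exists (strand_path s0); first by rewrite inE eqxx.
  by rewrite /strand_path inE mem_rcons inE; case: (s0.1); rewrite /= eqxx ?orbT.
- exists (strand_path s0); first by rewrite inE eqxx.
  by rewrite /strand_path inE mem_rcons inE; case: (s0.1); rewrite /= eqxx ?orbT.
case/flattenP=> p /mapP[s sL ->] xs; exists (strand_path s); first exact: map_f.
by rewrite /strand_path inE mem_rcons inE xs !orbT.
Qed.

End Linkage.

(** * Greedy enlargement of a linkage with both directions *)

Lemma near_regular_outdeg (T : finType) k (D : rel T) x :
  near_regular k D -> 2 * outdeg D x + 1 <= #|T| + k.
Proof.
case=> tD deg; have [_] := deg x; have := outdeg_indeg tD x.
by have : 0 < #|T| by [apply/card_gt0P; exists x]; lia.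
Qed.

(** If nothing can be inserted, the left-over part [A] is closed under out-neighbours, or [B] under
    in-neighbours. Then [#|T| <= #|A| + k], while [A] lies in the out-neighbourhood of [u], so
    [2 * #|A| + 1 <= #|T| + k]; together these give [#|T| < 3 * k]. The case of [B] is dual. *)
Lemma linkage_extend (T : finType) k (D : rel T) u v L x :
  near_regular k D -> 3 * k <= #|T| -> u != v -> linkage D u v L ->
  (forall d, d \in map fst L) -> x \notin u :: v :: inner L ->
  exists L', [/\ linkage D u v L', size L' = size L, forall d, d \in map fst L'
               & size (inner L) < size (inner L')].
Proof.
move=> regD nk uv linkL both xL; have tD := proj1 regD.
have strL d p : (d, p) \in L -> path D (tip u v d) (rcons p (tip u v (~~ d))).
  by case/andP: linkL => /allP sL _ /sL /andP[].
have ext d p xs p' : (d, p) \in L -> xs != [::] -> uniq (xs ++ u :: v :: inner L) ->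
    perm_eq p' (xs ++ p) -> path D (tip u v d) (rcons p' (tip u v (~~ d))) ->
    exists L', [/\ linkage D u v L', size L' = size L, forall d, d \in map fst L'
               & size (inner L) < size (inner L')].
  move=> dpL xs0 uxs pp' pth.
  have [L' [linkL' szL' fstL' perm_in]] := linkage_replace linkL dpL uxs pp' pth.
  exists L'; split=> // [d'|]; first by rewrite fstL'.
  by rewrite (perm_size perm_in) size_cat -[X in X < _]add0n ltn_add2r lt0n size_eq0.
set NL := [set y | y \notin u :: v :: inner L].
(* The two disjuncts are the hypotheses of [path_insert_head] and [path_insert_last]. *)
pose insertable y (s : bool * seq T) :=
  let a := tip u v s.1 in let b := tip u v (~~ s.1) in
  (D a y && has (D y) (rcons s.2 b)) || (D y b && has (converse D y) (a :: s.2)).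
have uLs : uniq (u :: v :: inner L) by case/andP: linkL.
have memI d p y : (d, p) \in L -> y \in p -> y \in inner L.
  by move=> dpL yp; apply/flattenP; exists p => //; apply: (map_f snd dpL).
case: (boolP [exists y in NL, has (insertable y) L]).
  case/exists_inP=> y; rewrite inE => yL /hasP[[d p] dpL ins].
  have ny : y \notin tip u v d :: rcons p (tip u v (~~ d)).
    apply: contra yL; rewrite inE mem_rcons inE !in_cons.
    by case/or3P=> [/eqP->|/eqP->|/(memI _ _ _ dpL) ->]; rewrite ?orbT //; case: (d); rewrite eqxx ?orbT.
  have [p' pp' pth] : exists2 p', perm_eq p' (y :: p)
       & path D (tip u v d) (rcons p' (tip u v (~~ d))).
    case/orP: ins => /andP[].
      exact: path_insert_head (strL _ _ dpL).
    exact: path_insert_last (strL _ _ dpL).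
  by apply: (ext d p [:: y] p') => //; rewrite cat1s cons_uniq yL.
move/exists_inPn=> nins.
have {}nins y d p : y \in NL -> (d, p) \in L -> ~~ insertable y (d, p).
  by move=> yNL dpL; apply: contra (nins y yNL) => iy; apply/hasP; exists (d, p).
have NLneq y : y \in NL -> (u != y) && (v != y).
  by rewrite !inE !negb_or ![y == _]eq_sym => /and3P[-> ->].
set A := [set y in NL | D u y && D v y]; set B := [set y in NL | D y u && D y v].
(* A left-over vertex that separates [u] from [v] fits into any strand of the matching direction,
   and both directions occur. *)
have NLAB y : y \in NL -> y \in A :|: B.
  move=> yNL; rewrite !inE -[X in _ && X || _]/(D u y && D v y).
  have := yNL; rewrite inE => ->; have /andP[uy vy] := NLneq y yNL.
  have /mapP[[d p] dpL /= dT] := both true; have /mapP[[d' p'] dpL' /= dF] := both false.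
  subst d d'; rewrite /= (tourN tD uy) (tourN tD vy).
  have := nins _ _ _ yNL dpL; have := nins _ _ _ yNL dpL'.
  rewrite /insertable /= !negb_or !negb_and (tourN tD uy) (tourN tD vy) !has_rcons.
  rewrite (tourN tD uy) (tourN tD vy).
  by case: (D u y); case: (D v y).
case: (boolP [exists a in A, [exists b in B, D a b]]).
  case/exists_inP=> a aA /exists_inP[b bB ab].
  have /mapP[[d [|c p]] dpL /= dT] := both true.
    by case/andP: linkL => /allP /(_ _ dpL).
  subst d; have := strL _ _ dpL => /= /andP[uc cp].
  move: aA bB; rewrite !in_set => /andP[aNL /andP[ua va]] /andP[bNL /andP[bu bv]].
  (* The pair goes between [u] and the first interior vertex [c]. If [c] dominated [b], then [b]
     alone could be inserted, since it dominates the end [v]. *)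
  have bc : D b c.
    apply: contraT => nbc; have := nins b true (c :: p) _ dpL; rewrite inE => /(_ bNL).
    have cI : c \in inner L by apply: memI dpL _; rewrite inE eqxx.
    have bcn : b != c by apply: contraNneq bNL => ->; rewrite !inE cI !orbT.
    by rewrite /insertable /= bv /converse /= (tourN tD bcn) nbc !orbT.
  apply: (ext true (c :: p) [:: a; b] [:: a, b, c & p]) => //; last by rewrite /= ua ab bc.
  by rewrite cat_cons cat1s !cons_uniq bNL in_cons negb_or aNL (tour_neq tD ab).
move/exists_inPn=> nAB.
have {}nAB a b : a \in A -> b \in B -> D a b = false.
  by move=> aA bB; apply/negbTE; apply: contra (nAB a aA) => ab; apply/exists_inP; exists b.
have xAB : x \in A :|: B by apply: NLAB; rewrite inE.
have inL y : y \notin NL -> [\/ y = u, y = v | exists d p, (d, p) \in L /\ y \in p].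
  rewrite inE negbK !inE => /or3P[/eqP|/eqP|]; [by constructor 1 | by constructor 2 |].
  by case/flattenP=> p /mapP[[d p'] dpL /= ->] yp; constructor 3; exists d, p'.
case/setUP: xAB => [xA|xB].
  have : #|T| <= #|A| + 2 * #|@set0 T| + k.
    apply: (out_closed_bound regD); first by apply/set0Pn; exists x.
    move=> a y aA ay; rewrite setU0; have := aA; rewrite inE => /and3P[aNL ua va].
    case: (boolP (y \in NL)) => [/NLAB/setUP[] // yB|/inL[yu|yv|[d [p [dpL yp]]]]].
    - by rewrite nAB in ay.
    - by rewrite yu (tour_asym tD ua) in ay.
    - by rewrite yv (tour_asym tD va) in ay.
    have := nins a d p aNL dpL; rewrite /insertable negb_or => /andP[/nandP[|/hasPn]] /=.
      by case: (d); rewrite /= ?ua ?va.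
    by move/(_ y); rewrite mem_rcons inE yp orbT ay => /(_ isT).
  have : #|A| <= outdeg D u.
    by apply: subset_leq_card; apply/subsetP=> y; rewrite !inE => /and3P[].
  by have := near_regular_outdeg u regD; rewrite cards0; lia.
have : #|T| <= #|B| + 2 * #|@set0 T| + k.
  apply: (in_closed_bound regD); first by apply/set0Pn; exists x.
  move=> b y bB yb; rewrite setU0; have := bB; rewrite inE => /and3P[bNL bu bv].
  case: (boolP (y \in NL)) => [/NLAB/setUP[] // yA|/inL[yu|yv|[d [p [dpL yp]]]]].
  - by rewrite nAB in yb.
  - by rewrite yu (tour_asym tD bu) in yb.
  - by rewrite yv (tour_asym tD bv) in yb.
  have := nins b d p bNL dpL; rewrite /insertable negb_or => /andP[_ /nandP[|/hasPn]] /=.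
    by case: (d); rewrite /= ?bu ?bv.
  by move/(_ y); rewrite inE yp orbT /converse yb => /(_ isT).
have : #|B| <= outdeg (converse D) u.
  by apply: subset_leq_card; apply/subsetP=> y; rewrite !inE => /and3P[].
by have := near_regular_outdeg u (near_regular_converse regD); rewrite cards0; lia.
Qed.

(** * The four classes of vertices relative to [u] and [v] *)

Section Classes.

Variables (T : finType) (D : rel T) (u v : T).

(* [cls true false] collects the interiors of the paths u -> z -> v, [cls false true] those of v -> z -> u. *)
Definition cls (a b : bool) : {set T} :=
  [set z | [&& z != u, z != v, D u z == a & D v z == b]].

Hypotheses (tD : is_tournament D) (uv : u != v).

Lemma clsP a b z : z \in cls a b ->
  [/\ z != u, z != v, D u z = a & D v z = b] /\ D z u = ~~ a /\ D z v = ~~ b.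
Proof.
rewrite inE => /and4P[nu nv /eqP <- /eqP <-]; split=> //.
by split; apply: (tourN tD); rewrite eq_sym.
Qed.

Lemma mem_cls z : z != u -> z != v -> z \in cls (D u z) (D v z).
Proof. by rewrite inE => -> ->; rewrite !eqxx. Qed.

Lemma cls_outdeg : outdeg D u = #|cls true true| + #|cls true false| + D u v.
Proof.
rewrite /outdeg (cardsD1 v) inE addnC; congr (_ + _).
rewrite -(cardsID [set y | D v y]); congr (_ + _); apply: eq_card => y; rewrite !inE;
  case: (eqVneq y u) => [->|nyu]; rewrite ?(tour_irr tD) ?andbF //=;
  by case: (D u y); case: (D v y); rewrite ?andbT ?andbF.
Qed.

Lemma cls_indeg : indeg D u = #|cls false false| + #|cls false true| + D v u.
Proof.
rewrite /indeg (cardsD1 v) inE addnC; congr (_ + _).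
rewrite -(cardsID [set y | D y v]); congr (_ + _); apply: eq_card => y; rewrite !inE;
  case: (eqVneq y u) => [->|nyu]; rewrite ?(tour_irr tD) ?andbF //=;
  case: (eqVneq y v) => [->|nyv]; rewrite ?andbF //= (tourN tD nyu) (tourN tD nyv);
  by case: (D y u); case: (D y v).
Qed.

End Classes.

Lemma clsC (T : finType) (D : rel T) u v a b : cls D u v a b = cls D v u b a.
Proof. by apply/setP=> z; rewrite !inE andbCA; do 2!congr (_ && _); rewrite andbC. Qed.

(** Each inequality is a degree bound at [u] or [v], or the sum of two of them, written in class
    sizes. Everything after this is linear arithmetic. *)
Lemma cls_balance (T : finType) k (D : rel T) u v : near_regular k D -> u != v ->
  let a := #|cls D u v true true| in let b := #|cls D u v false false| in
  let c := #|cls D u v true false| in let e := #|cls D u v false true| in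
  [/\ a + b + c + e + 2 = #|T|, #|T| <= a + b + 2 * c + k + 1 + 2 * D u v
    & #|T| <= a + b + 2 * e + k + 1 + 2 * D v u] /\
  [/\ #|T| <= 2 * a + c + e + k + 2, #|T| <= 2 * b + c + e + k + 2,
      2 * (a + c + D u v) <= #|T| + k - 1 & 2 * (b + e + D v u) <= #|T| + k - 1] /\
  [/\ 2 * (a + e + D v u) <= #|T| + k - 1, 2 * (b + c + D u v) <= #|T| + k - 1
    & D u v + D v u = 1].
Proof.
move=> regD uv a b c e; have tD := proj1 regD.
have [du du'] := proj2 regD u; have [dv dv'] := proj2 regD v.
have su := outdeg_indeg tD u; have sv := outdeg_indeg tD v.
have T0 : 0 < #|T| by apply/card_gt0P; exists u.
have uv1 : D u v + D v u = 1 by rewrite (tourN tD uv); case: (D u v).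
move: su sv du du' dv dv'; rewrite (cls_outdeg u v tD) (cls_indeg u v tD).
rewrite (cls_outdeg v u tD) (cls_indeg v u tD).
rewrite !(clsC D v u) -/a -/b -/c -/e.
by move=> *; split; [|split]; split; lia.
Qed.

(** * The initial linkage, built on a maximal matching from [A] to [B] *)

Section InitialLinkage.

Variables (T : finType) (k : nat) (D : rel T) (u v : T).
Hypotheses (regD : near_regular k D) (uv : u != v).

Let tD := proj1 regD.
Let A := cls D u v true true.
Let B := cls D u v false false.
Let C := cls D u v true false.
Let E := cls D u v false true.

Definition matching (M : seq (T * T)) : bool :=
  [&& uniq (map fst M), uniq (map snd M)
    & all (fun m => [&& m.1 \in A, m.2 \in B & D m.1 m.2]) M].

Lemma ex_maximal_matching : exists2 M, matching M &
  forall a b, a \in A -> b \in B -> D a b -> (a \in map fst M) || (b \in map snd M).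
Proof.
apply: (@climb _ size #|T| (fun M => matching M) _ _ _ [::]) => // [M /and3P[u1 _ _]|M].
  by rewrite -(size_map fst) -(card_uniqP u1) max_card.
case/and3P=> u1 u2 allM.
case: (boolP [exists a in A, [exists b in B, [&& D a b, a \notin map fst M & b \notin map snd M]]]).
  case/exists_inP=> a aA /exists_inP[b bB /and3P[ab na nb]]; right; exists ((a, b) :: M) => //.
  by rewrite /matching /= na nb u1 u2 aA bB ab.
move/exists_inPn=> none; left=> a b aA bB ab; apply: contraT; rewrite negb_or => /andP[na nb].
by have /exists_inPn/(_ b bB) := none a aA; rewrite ab na nb.
Qed.

(** A matching arc can be run from [u] to [v] or from [v] to [u], as both dominate [A] and are
    dominated by [B]; [o] records the choice. *)
Definition seed (o : T * T -> bool) (M : seq (T * T)) : seq (bool * seq T) :=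
  [seq (o m, [:: m.1; m.2]) | m <- M] ++
  [seq (true, [:: x]) | x <- enum C] ++ [seq (false, [:: x]) | x <- enum E].

Lemma seed_linkage o M : matching M -> linkage D u v (seed o M).
Proof.
case/and3P=> u1 u2 /allP allM.
have inM m : m \in M -> [/\ m.1 \in A, m.2 \in B & D m.1 m.2] by move/allM/and3P.
have inA x : x \in map fst M -> x \in A by case/mapP=> m /inM[? _ _] ->.
have inB x : x \in map snd M -> x \in B by case/mapP=> m /inM[_ ? _] ->.
have innerM : perm_eq (inner [seq (o m, [:: m.1; m.2]) | m <- M]) (map fst M ++ map snd M).
  elim: (M) => // m M' IH; apply/permP=> p; have /permP/(_ p) := IH.
  by rewrite /inner /= !count_cat /=; lia.
have inner1 d s : inner [seq (d, [:: x]) | x <- s] = s :> seq T.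
  by elim: s => //= x s IH; rewrite /inner /= -[X in _ :: X]/(inner _) IH.
apply/andP; split.
  rewrite !all_cat !all_map; apply/and3P; split; apply/allP=> x.
  - case/inM=> /(clsP tD)[[_ _ ua va] _] /(clsP tD)[_ [bu bv]] ab.
    by rewrite /= /strand /= ab; case: (o x); rewrite /= ?ua ?va ?bu ?bv.
  - by rewrite mem_enum => /(clsP tD)[[_ _ ux _] [_ xv]]; rewrite /= /strand /= ux xv.
  by rewrite mem_enum => /(clsP tD)[[_ _ _ vx] [xu _]]; rewrite /= /strand /= vx xu.
rewrite /seed !inner_cat !inner1.
set s := _ ++ _; have memS x : x \in s -> [|| x \in A, x \in B, x \in C | x \in E].
  by rewrite !mem_cat (perm_mem innerM) mem_cat !mem_enum => /or3P[/orP[/inA|/inB]|->|->] => [->|->||]; rewrite ?orbT.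
have nuv x : x \in s -> (x != u) && (x != v).
  by move/memS => /or4P[] /(clsP tD)[[-> ->]].
rewrite /= inE negb_or uv /=; apply/and3P; split.
- by apply/negP=> /nuv; rewrite eqxx.
- by apply/negP=> /nuv; rewrite eqxx andbF.
have -> : uniq s = uniq ((map fst M ++ map snd M) ++ enum C ++ enum E).
  by apply: perm_uniq; rewrite perm_cat2r.
rewrite !cat_uniq u1 u2 !enum_uniq /= !andbT; apply/and3P; split.
- apply/hasPn=> x /inB /(clsP tD)[[_ _ ux _] _]; apply/negP=> /inA /(clsP tD)[[_ _]].
  by rewrite ux.
- apply/hasPn=> x; rewrite mem_cat !mem_enum => xCE.
  apply/negP; rewrite mem_cat => xAB.
  case/orP: xCE => /(clsP tD)[[_ _ ux vx] _];
  by case/orP: xAB => [/inA|/inB] /(clsP tD)[[_ _]]; rewrite ux vx.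
apply/hasPn=> x; rewrite mem_enum => /(clsP tD)[[_ _ ux _] _].
by apply/negP; rewrite mem_enum => /(clsP tD)[[_ _]]; rewrite ux.
Qed.

(* The unmatched vertices of [A] send no arc to those of [B], so the vertices outside both sets separate them;
   near-regularity makes every such separator large. *)
Lemma maximal_matching_size t M : 2 <= t -> 6 * t + 5 * k - 3 <= #|T| -> matching M ->
  (forall a b, a \in A -> b \in B -> D a b -> (a \in map fst M) || (b \in map snd M)) ->
  [/\ t < size M + #|C| + #|E|, #|E| = 0 -> 1 < size M & 0 < size M + #|C|].
Proof.
move=> t2 nT /and3P[u1 u2 /allP allM] maxM.
pose X := [set x in map fst M]; pose Y := [set x in map snd M].
have cX : #|X| = size M by rewrite cardsE (card_uniqP u1) size_map.
have cY : #|Y| = size M by rewrite cardsE (card_uniqP u2) size_map.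
have XA : X \subset A by apply/subsetP=> x; rewrite inE => /mapP[m /allM /and3P[? _ _] ->].
have YB : Y \subset B by apply/subsetP=> x; rewrite inE => /mapP[m /allM /and3P[_ ? _] ->].
pose W := X :|: Y :|: C :|: E.
have cW : #|W| <= 2 * size M + #|C| + #|E|.
  have [] := leq_card_setU X Y; have [] := leq_card_setU (X :|: Y) C.
  by have [] := leq_card_setU (X :|: Y :|: C) E; rewrite -/W; lia.
have split4 y : y != u -> y != v -> [|| y \in A, y \in B, y \in C | y \in E].
  move=> yu yv; have := mem_cls D yu yv.
  by case: (D u y); case: (D v y) => ->; rewrite ?orbT.
(* Out-neighbours of an unmatched vertex of [A] avoid [u] and [v], which dominate it, and by
   maximality avoid the unmatched part of [B]. *)
have boundA : (#|A| <= size M) \/ #|T| <= #|A| - size M + 2 * #|W| + k.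
  have cAX : #|A :\: X| = #|A| - size M by rewrite cardsDS // cX.
  case: (eqVneq (A :\: X) set0) => [A0|A0]; [left | right].
    by rewrite -subn_eq0 -cAX A0 cards0.
  rewrite -cAX; apply: (out_closed_bound regD A0) => x y; rewrite inE => /andP[xX xA] xy.
  have [[_ _ ux vx] _] := clsP tD xA.
  have yu : y != u by apply: contraTneq xy => ->; rewrite (tour_asym tD ux).
  have yv : y != v by apply: contraTneq xy => ->; rewrite (tour_asym tD vx).
  rewrite in_setU in_setD; case/or4P: (split4 y yu yv) => [yA|yB|yC|yE].
  - by rewrite yA andbT in_setU in_setU in_setU; case: (y \in X).
  - have := maxM x y xA yB xy; rewrite inE in xX; rewrite (negbTE xX) /= => yY.
    by rewrite !in_setU [y \in Y]inE yY !orbT.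
  - by rewrite !in_setU yC !orbT.
  by rewrite !in_setU yE !orbT.
have boundB : (#|B| <= size M) \/ #|T| <= #|B| - size M + 2 * #|W| + k.
  have cBY : #|B :\: Y| = #|B| - size M by rewrite cardsDS // cY.
  case: (eqVneq (B :\: Y) set0) => [B0|B0]; [left | right].
    by rewrite -subn_eq0 -cBY B0 cards0.
  rewrite -cBY; apply: (in_closed_bound regD B0) => x y; rewrite inE => /andP[xY xB] yx.
  have [_ [xu xv]] := clsP tD xB.
  have yu : y != u by apply: contraTneq yx => ->; rewrite (tour_asym tD xu).
  have yv : y != v by apply: contraTneq yx => ->; rewrite (tour_asym tD xv).
  rewrite in_setU in_setD; case/or4P: (split4 y yu yv) => [yA|yB|yC|yE].
  - have := maxM y x yA xB yx; rewrite inE in xY; rewrite (negbTE xY) orbF => yX.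
    by rewrite !in_setU [y \in X]inE yX !orbT.
  - by rewrite yB andbT !in_setU; case: (y \in Y); rewrite ?orbT.
  - by rewrite !in_setU yC !orbT.
  by rewrite !in_setU yE !orbT.
have := cls_balance regD uv; rewrite -/A -/B -/C -/E /=.
have := subset_leq_card XA; have := subset_leq_card YB; rewrite cX cY.
move: boundA boundB cW nT.
move: #|W| #|A| #|B| #|C| #|E| #|T| (size M) (nat_of_bool (D u v)) (nat_of_bool (D v u)).
clear -t2 => w a b c e n m d d' boundA boundB cW nT mb ma.
case=> -[? ? ?] [[? ? ? ?] [? ? ?]].
(* If both unmatched parts are nonempty, the two bounds add up to [n <= 3(2m + c + e) + 2k - 2];
   this is where the threshold [6t + 5k - 3] comes from. If one is empty, [n <= 2m + c + e + k + 2]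
   by the degree bounds, which is stronger. *)
have sep : 2 * t + k <= 2 * m + c + e by case: boundA; case: boundB; lia.
(* The balance inequalities keep [c] and [e] within [k + 1] of each other and exclude
   [k = c = e = 0]. *)
by have [?|?] : d = 0 \/ d = 1 by [lia]; split; lia.
Qed.

Lemma ex_initial_linkage t : 2 <= t -> 6 * t + 5 * k - 3 <= #|T| ->
  exists L, [/\ linkage D u v L, t < size L & forall d, d \in map fst L].
Proof.
move=> t2 nT; have [M matM maxM] := ex_maximal_matching.
have [szL E0 MC0] := maximal_matching_size t2 nT matM maxM.
have fstL o d : (d \in map fst (seed o M)) =
    [|| d \in map o M, d && (0 < #|C|) | ~~ d && (0 < #|E|)].
  have fst1 b (S : {set T}) :
      (d \in map fst [seq (b, [:: x]) | x <- enum S]) = (d == b) && (0 < #|S|).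
    rewrite -map_comp cardE; case: (enum S) => [|x s]; rewrite ?andbF //= andbT inE.
    by case: eqP => //= db; apply/negbTE/negP=> /mapP[y _ /db].
  by rewrite /seed !map_cat !mem_cat !fst1 -map_comp; case: (d).
have szseed o : size (seed o M) = size M + #|C| + #|E|.
  by rewrite /seed !size_cat !size_map -!cardE addnA.
(* If [E] is nonempty it supplies the direction from [v] to [u], and all matching arcs are run from
   [u] to [v]. Otherwise there are two matching arcs, and the first alone is run from [v] to [u]. *)
have [E00|E_gt0] := posnP #|E|; last first.
  exists (seed xpredT M); split; rewrite ?szseed //; first exact: seed_linkage.
  case; rewrite fstL E_gt0 /= ?orbT ?orbF //.
  by case: (M) MC0 => [|m M'] /=; rewrite ?inE // add0n => ->.
have {}E0 := E0 E00.
case: M matM {maxM MC0} szL fstL szseed E0 => [|m [|m' M]] // matM szL fstL szseed _.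
exists (seed (predC1 m) [:: m, m' & M]); split; rewrite ?szseed //; first exact: seed_linkage.
have nm : m' != m.
  case/and3P: matM => /= /andP[nm _] _ _; apply: contraNneq nm => ->.
  by rewrite inE eqxx.
by case; rewrite fstL /= !inE ?eqxx //= nm ?orbT.
Qed.

End InitialLinkage.

Lemma linkage_span (T : finType) k (D : rel T) u v L :
  near_regular k D -> 3 * k <= #|T| -> u != v -> linkage D u v L ->
  (forall d, d \in map fst L) ->
  exists L', [/\ linkage D u v L', size L' = size L & forall x, x \in u :: v :: inner L'].
Proof.
move=> regD nk uv linkL both.
pose good L' := [/\ linkage D u v L', size L' = size L & forall d, d \in map fst L'].
have [L' [link' sz' _] span] : exists2 L', good L' & forall x, x \in u :: v :: inner L'.
  apply: (@climb _ (fun L' => size (inner L')) #|T| good _ _ _ L); last by split.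
    move=> L' [/andP[_ /and3P[_ _ uI]] _ _]; by rewrite -(card_uniqP uI) max_card.
  move=> L' [link' sz' both'].
  case: (boolP [forall x, x \in u :: v :: inner L']) => [/forallP|/forallPn[x xL']].
    by left.
  have [L2 [link2 sz2 both2 lt2]] := linkage_extend regD nk uv link' both' xL'.
  by right; exists L2 => //; split=> //; rewrite sz2.
by exists L'; split.
Qed.

(** * One spanning path, through a Hamiltonian cycle of [V] *)

Section SpanningStrand.

Variables (T : finType) (k : nat) (D : rel T) (u v : T).
Hypotheses (regD : near_regular k D) (uv : u != v) (nT : 5 * k + 9 <= #|T|).

Let tD := proj1 regD.
Let V := ~: [set u; v].

Lemma inV x : (x \in V) = (x != u) && (x != v).
Proof. by rewrite !inE negb_or. Qed.

Lemma cardV : #|V| + 2 = #|T|.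
Proof. by have := cardsC [set u; v]; rewrite cards2 uv -/V addnC. Qed.

(** This is strong connectivity of the tournament on [V]. Without such an arc, [S] is out-closed and
    [V :\: S] in-closed up to [u] and [v]; adding the two bounds gives [#|T| <= 2 * k + 6]. *)
Lemma arc_out (S : {set T}) : S \subset V -> S != set0 -> V :\: S != set0 ->
  exists x y, [/\ x \in S, y \in V, y \notin S & D x y].
Proof.
move=> SV S0 S'0.
case: (boolP [exists x in S, [exists y in V :\: S, D x y]]).
  by case/exists_inP=> x xS /exists_inP[y /setDP[yV yS] xy]; exists x, y.
move/exists_inPn=> none.
have {}none x y : x \in S -> y \in V :\: S -> ~~ D x y.
  by move=> /none /exists_inPn; apply.
have Vuv x : (x \in V) || (x \in [set u; v]) by rewrite [x \in V]inE orNb.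
have : #|T| <= #|S| + 2 * #|[set u; v]| + k.
  apply: (out_closed_bound regD S0) => x y xS xy; rewrite inE.
  case/orP: (Vuv y) => [yV|->]; last by rewrite orbT.
  by apply: contraLR xy; rewrite negb_or => /andP[yS _]; rewrite none // inE yS.
have : #|T| <= #|V :\: S| + 2 * #|[set u; v]| + k.
  apply: (in_closed_bound regD S'0) => y x yS xy; rewrite in_setU.
  case/orP: (Vuv x) => [xV|->]; last by rewrite orbT.
  apply: contraLR xy; rewrite negb_or in_setD xV andbT negbK => /andP[xS _].
  exact: none.
rewrite cards2 uv; have := cardsDS SV; have := subset_leq_card SV.
by have := cardV; lia.
Qed.

(** An arc of [V] that leaves the out-neighbourhood of [x] ends at a vertex dominating [x]. The
    triangle starts the growth of the Hamiltonian cycle. *)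
Lemma ex_triangle : exists x y z, [/\ [&& x \in V, y \in V & z \in V], D x y, D y z & D z x].
Proof.
have /card_gt0P[x xV] : 0 < #|V| by have := cardV; lia.
have V1 (S : {set T}) : #|S| < #|V| -> V :\: S != set0.
  move=> SV; rewrite -card_gt0 cardsD subn_gt0; apply: leq_ltn_trans SV.
  by apply: subset_leq_card; apply: subsetIr.
have [x' [y [/set1P-> yV _ xy]]] : exists x' y, [/\ x' \in [set x], y \in V, y \notin [set x] & D x' y].
  apply: arc_out; rewrite ?sub1set //; last by apply: V1; rewrite cards1; have := cardV; lia.
  by apply/set0Pn; exists x; rewrite inE.
have [y' [z [y'S zV zS y'z]]] : exists y' z, [/\ y' \in V :&: [set y | D x y], z \in V,
    z \notin V :&: [set y | D x y] & D y' z].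
  apply: arc_out; first exact: subsetIl.
    by apply/set0Pn; exists y; rewrite in_setI yV inE.
  by apply/set0Pn; exists x; rewrite in_setD in_setI xV inE tour_irr.
move: y'S; rewrite in_setI inE => /andP[y'V xy'].
exists x, y', z; rewrite xV y'V zV; split=> //.
have xz : x != z by apply: contraTneq y'z => <-; rewrite (tour_asym tD xy').
by rewrite (tourN tD xz); apply: contra zS => ?; rewrite in_setI zV inE.
Qed.

(** The cycle is seen as a path from [a] back to [a] and grown as in [linkage_extend]. When stuck,
    left-over vertices in [O] dominate no cycle vertex and those in [I] are dominated by none; with
    no arc from [O] to [I], this contradicts [arc_out]. *)
Lemma ex_hamiltonian_cycle : exists c, [/\ cycle D c, uniq c & c =i V].
Proof.
pose good c := [/\ cycle D c, uniq c, c != [::] & {subset c <= V}].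
have [c [cyc uc _ cV] Vc] : exists2 c, good c & {subset V <= c}; last first.
  by exists c; split=> // x; apply/idP/idP; [apply: cV | apply: Vc].
have [x [y [z [/and3P[xV yV zV] xy yz zx]]]] := ex_triangle.
have start : good [:: x; y; z].
  split=> //=; first by rewrite xy yz zx.
    rewrite !inE negb_or (tour_neq tD xy) (tour_neq tD yz) eq_sym.
    by rewrite (tour_neq tD zx).
  by move=> s; rewrite !in_cons in_nil orbF => /or3P[] /eqP->.
apply: (@climb _ size #|T| good _ _ _ _ start) => {x y z xV yV zV xy yz zx start} c.
  by case=> _ uc _ _; rewrite -(card_uniqP uc) max_card.
case=> cyc uc c0 cV.
case: (boolP [forall x, (x \in V) ==> (x \in c)]).
  by move/forallP=> h; left=> s; apply/implyP.
case/forallPn=> z; rewrite negb_imply => /andP[zV zc]; right.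
case: c c0 cyc uc cV zc => // a q _ cyc uc cV zc.
have ext xs q' : perm_eq q' (xs ++ q) -> xs != [::] -> uniq (xs ++ a :: q) ->
    {subset xs <= V} -> path D a (rcons q' a) ->
    exists2 b, good b & size (a :: q) < size b.
  move=> pq xs0 uxs xsV pth.
  have pc : perm_eq (a :: q') (xs ++ a :: q).
    apply: (@perm_trans _ (a :: xs ++ q)); first by rewrite perm_cons.
    by rewrite -cat1s -[a :: q]cat1s perm_catCA.
  exists (a :: q'); last first.
    by rewrite (perm_size pc) size_cat -[X in X < _]add0n ltn_add2r lt0n size_eq0.
  split=> //; first by rewrite (perm_uniq pc).
  by move=> s; rewrite (perm_mem pc) mem_cat => /orP[/xsV|/cV].
pose insertable s := (D a s && has (D s) (rcons q a)) || (D s a && has (converse D s) (a :: q)).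
case: (boolP [exists s in V :\: [set s in a :: q], insertable s]).
  case/exists_inP=> s; rewrite in_setD inE => /andP[sc sV] ins.
  have sn : s \notin a :: rcons q a by rewrite in_cons mem_rcons in_cons orbA orbb -in_cons.
  have [q' pq pth] : exists2 q', perm_eq q' (s :: q) & path D a (rcons q' a).
    case/orP: ins => /andP[].
      exact: path_insert_head.
    exact: path_insert_last.
  apply: (ext [:: s] q') => //; first by rewrite cat1s cons_uniq sc.
  by move=> r; rewrite inE => /eqP->.
move/exists_inPn=> nins.
set L := V :\: [set s in a :: q] in nins.
have inL s : (s \in L) = (s \in V) && (s \notin a :: q) by rewrite in_setD inE andbC.
set O := [set s in L | D a s]; set I := [set s in L | D s a].
have neqL r s : r \in a :: q -> s \in L -> r != s.
  by move=> rc; rewrite inL => /andP[_]; apply: contraNneq => <-.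
have allO s r : s \in O -> r \in a :: q -> D s r = false.
  rewrite inE => /andP[sL as_] rc; have := nins s sL; rewrite /insertable as_ negb_or.
  case/andP=> /hasPn/(_ r) h _; apply/negbTE/h.
  by rewrite mem_rcons.
have allI s r : s \in I -> r \in a :: q -> D r s = false.
  rewrite inE => /andP[sL sa] rc; have := nins s sL; rewrite /insertable sa negb_or.
  by case/andP=> _ /hasPn/(_ r rc) /negbTE.
have LOI s : s \in L -> (s \in O) || (s \in I).
  move=> sL; have /(tourN tD) := neqL a s (mem_head _ _) sL.
  by rewrite [s \in O]inE [s \in I]inE sL /= => ->; rewrite orbN.
have OV : O \subset V by apply/subsetP=> s; rewrite inE inL => /andP[/andP[]].
have IV : I \subset V by apply/subsetP=> s; rewrite inE inL => /andP[/andP[]].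
have aV : a \in V by apply: cV; rewrite inE eqxx.
case: (boolP [exists o in O, [exists i in I, D o i]]).
  case/exists_inP=> o oO /exists_inP[i iI oi].
  have oL : o \in L by move: oO; rewrite inE => /andP[].
  have iL : i \in L by move: iI; rewrite inE => /andP[].
  apply: (ext [:: o; i] [:: o, i & q]) => //.
  - move: oL iL; rewrite !inL => /andP[_ oc] /andP[_ ic].
    by rewrite cat_cons cat1s !cons_uniq ic in_cons negb_or (tour_neq tD oi) oc.
  - by move=> r; rewrite !in_cons in_nil orbF => /orP[/eqP->|/eqP->];
        [apply: (subsetP OV) | apply: (subsetP IV)].
  have ao : D a o by move: oO; rewrite inE => /andP[].
  have ir r : r \in rcons q a -> D i r.
    by rewrite mem_rcons => rc; rewrite (tourN tD (neqL r i rc iL)) (allI i r iI rc).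
  (* The cycle is opened right after [a]: [i] dominates every cycle vertex, in particular the
     successor of [a]. *)
  move: cyc ir; rewrite /= ao oi /=; case: (rcons q a) => //= b q' /andP[_ ->] ir.
  by rewrite ir ?mem_head.
move/exists_inPn=> nOI.
have {}nOI o i : o \in O -> i \in I -> D o i = false.
  by move=> oO iI; apply/negbTE; have /exists_inPn := nOI o oO; apply.
have zL : z \in L by rewrite inL zV.
case/orP: (LOI z zL) => [zO|zI].
  have [||o [s [oO sV sO os]]] := arc_out OV.
  - by apply/set0Pn; exists z.
  - apply/set0Pn; exists a; rewrite in_setD aV andbT.
    by apply/negP; rewrite inE inL mem_head andbF.
  case: (boolP (s \in a :: q)) => [sc|sc]; first by rewrite allO in os.
  have /LOI : s \in L by rewrite inL sV.
  by rewrite (negbTE sO) /= => sI; rewrite nOI in os.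
have [|||s [i [sI iV iI si]]] := @arc_out (V :\: I).
- exact: subsetDl.
- apply/set0Pn; exists a; rewrite in_setD aV andbT.
  by apply/negP; rewrite inE inL mem_head andbF.
- by apply/set0Pn; exists z; rewrite !in_setD zI zV.
move: iI sI; rewrite !in_setD iV andbT negbK => iI /andP[sI sV].
case: (boolP (s \in a :: q)) => [sc|sc]; first by rewrite allI in si.
have /LOI : s \in L by rewrite inL sV.
by rewrite (negbTE sI) orbF => sO; rewrite nOI in si.
Qed.

(* [closes y x] holds if a path from [x] to [y] is the interior of a strand. *)
Definition closes : rel T := fun y x => (D u x && D y v) || (D v x && D y u).

(** Deleting an arc from [x] to [y] leaves a path from [y] to [x] through the same vertices. Either
    some such path closes up to a strand, or every arc of the cycle obeys a local constraint. *)
Lemma cycle_break c : cycle D c -> uniq c ->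
  cycle (fun x y => D x y && ~~ closes x y) c \/
  exists x q, [/\ perm_eq (x :: q) c, path D x q & closes (last x q) x].
Proof.
move=> cyc uc; case: (boolP (all (fun x => ~~ closes x (next c x)) c)) => [/allP nc|].
  left; have cn := cycle_next uc.
  have sub : {in mem c &, subrel (frel (next c)) (fun x y => D x y && ~~ closes x y)}.
    move=> x y xc _ /eqP <-; rewrite (next_cycle cyc xc); exact: nc.
  by apply: (sub_in_cycle sub) cn; apply/allP.
case/allPn=> y yc; rewrite negbK => cl; right.
have [i q rq] := rot_to yc.
have cyc' : cycle D (y :: q) by rewrite -rq rot_cycle.
have uq : uniq (y :: q) by rewrite -rq rot_uniq.
case: q rq cyc' uq => [|x q] rq cyc' uq; first by move: cyc'; rewrite /= tour_irr.
exists x, (rcons q y); split.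
- have /permPr <- : perm_eq (y :: x :: q) c by rewrite -rq perm_rot.
  by rewrite -rcons_cons perm_rcons.
- by case/andP: cyc'.
by rewrite last_rcons; move: cl; rewrite -(next_rot i uc) rq /= eqxx.
Qed.

Lemma cycle_propagate (e : rel T) (P : pred T) c x :
  {in c &, forall x y, e x y -> P x -> P y} -> cycle e c -> x \in c -> P x -> all P c.
Proof.
move=> eP cyc /rot_to[i q rq] Px.
have /allP qc : all (mem c) (x :: q) by rewrite -rq; apply/allP=> y; rewrite mem_rot.
have : path e x q by move: cyc; rewrite -(rot_cycle i) rq /= rcons_path => /andP[].
rewrite -(eq_all_r (mem_rot i c)) rq /= Px /=.
elim: q x Px qc {rq} => //= y q IH x Px qc /andP[xy yq].
have Py : P y by apply: eP xy Px; apply: qc; rewrite !inE eqxx ?orbT.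
by rewrite Py; apply: IH yq => // z zq; apply: qc; rewrite inE zq orbT.
Qed.

(** Three vertices are too few to contain the in- or out-neighbourhood of any vertex. *)
Lemma card_sub3_lt (S : {set T}) a b e :
  S \subset [set a; b; e] -> 2 * #|S| + k + 1 < #|T|.
Proof.
move=> /subset_leq_card; have [] := leq_card_setU [set a; b] [set e].
have [] := leq_card_setU [set a] [set b]; rewrite !cards1; move: nT; clear; lia.
Qed.

(* If no arc of the Hamiltonian cycle can be cut, its vertices alternate between [cls true false] and
   [cls false true]; a strand then starts and ends in the same class, which is achieved by moving one
   vertex of the cycle. *)
Lemma ex_spanning_strand : exists d p, [/\ p != [::], uniq p, p =i V
  & path D (tip u v d) (rcons p (tip u v (~~ d)))].
Proof.
have [c [cyc uc cV]] := ex_hamiltonian_cycle.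
have fin x q : perm_eq (x :: q) c -> path D x q -> closes (last x q) x ->
    exists d p, [/\ p != [::], uniq p, p =i V & path D (tip u v d) (rcons p (tip u v (~~ d)))].
  move=> pq pth cl; have uq : uniq (x :: q) by rewrite (perm_uniq pq).
  have qV : x :: q =i V by move=> s; rewrite (perm_mem pq) cV.
  case/orP: cl => /andP[h1 h2]; [exists true | exists false]; exists (x :: q); split=> //;
    by rewrite /= h1 rcons_path pth h2.
case: (cycle_break cyc uc) => [cyce|[x [q [pq pth cl]]]]; last exact: fin cl.
have [[cardE _ _] [[_ _ outu inu] _]] := cls_balance regD uv.
have nall a : ~ {in V, forall x, x \in cls D u v a a}.
  move=> all_a; have /subset_leq_card : V \subset cls D u v a a by apply/subsetP.
  by have := cardV; case: a {all_a}; lia.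
have Vuv x : x \in V -> (u != x) && (v != x) by rewrite inV ![x == _]eq_sym.
have cycP (P : pred T) x : {in V &, forall r s, D r s -> ~~ closes r s -> P r -> P s} ->
    x \in V -> P x -> {in V, forall y, P y}.
  move=> stepP xV Px y; rewrite -cV; apply/allP.
  apply: (cycle_propagate (x := x) _ cyce); rewrite ?cV // => r s rc sc /andP[].
  by apply: stepP; rewrite -cV.
(* Along an arc that cannot be cut, membership in [cls D u v false false] passes from tail to head,
   so one such vertex would put all of [V] in that class. For [cls D u v true true], treated next,
   it is non-membership that propagates. *)
have nB x : x \in V -> ~~ (D x u && D x v).
  move=> xV; apply/negP=> Bx; apply: (nall false) => y yV.
  have: D y u && D y v.
    apply: (cycP (fun z => D z u && D z v) x) => // r s rV sV _.
    have [/andP[us vs] /andP[ur vr]] := (Vuv s sV, Vuv r rV).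
    rewrite /closes (tourN tD us) (tourN tD vs) => + /andP[ru rv]; rewrite ru rv.
    by case: (D u s); case: (D v s).
  case/andP=> yu yv; move: (yV); rewrite inV => /andP[nu nv].
  by rewrite inE nu nv (tour_asym tD yu) (tour_asym tD yv).
have nA x : x \in V -> ~~ (D u x && D v x).
  move=> xV; apply/negP=> Ax.
  have [y yV nAy] : exists2 y, y \in V & ~~ (D u y && D v y).
    apply/exists_inP; apply: contraT => /exists_inPn allA; case: (nall true) => y yV.
    by move: (yV) (allA y yV); rewrite negbK inV inE => /andP[-> ->] /andP[-> ->].
  have : ~~ (D u x && D v x); last by rewrite Ax.
  apply: (cycP (fun z => ~~ (D u z && D v z)) y) => // r s rV sV _.
  have [/andP[us vs] /andP[ur vr]] := (Vuv s sV, Vuv r rV).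
  rewrite /closes (tourN tD ur) (tourN tD vr).
  by case: (D u s); case: (D v s); case: (D u r); case: (D v r).
have flip x : x \in V -> D v x = ~~ D u x.
  move=> xV; have /andP[ux vx] := Vuv x xV.
  have := nB x xV; have := nA x xV; rewrite (tourN tD ux) (tourN tD vx).
  by case: (D u x); case: (D v x).
have alt x y : x \in V -> y \in V -> ~~ closes x y -> D u y = ~~ D u x.
  move=> xV yV; have /andP[ux vx] := Vuv x xV.
  rewrite /closes (tourN tD ux) (tourN tD vx) !flip // !negbK.
  by case: (D u x); case: (D u y).
have fin2 x q y : perm_eq (x :: rcons q y) c -> path D x (rcons q y) -> D u x = D u y ->
    exists d p, [/\ p != [::], uniq p, p =i V & path D (tip u v d) (rcons p (tip u v (~~ d)))].
  move=> pq pth xy; apply: (fin _ _ pq pth); rewrite last_rcons.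
  have xV : x \in V by rewrite -cV -(perm_mem pq) mem_head.
  have yV : y \in V by rewrite -cV -(perm_mem pq) inE mem_rcons mem_head orbT.
  have /andP[uy vy] := Vuv y yV.
  by rewrite /closes (tourN tD uy) (tourN tD vy) !flip // xy; case: (D u y).
have szc : size c = #|V| by rewrite -(card_uniqP uc); apply: eq_card.
have : 4 < size c by have := cardV; lia.
case: c cyc uc cV {fin cycP szc} cyce fin2 => [|x [|y [|z [|t l]]]] //.
case/lastP: l => // l w cyc uc cV cyce fin2 _.
move: (cyce); rewrite /= !rcons_path last_rcons.
case/and5P=> /andP[xy nxy] /andP[yz nyz] /andP[zt nzt].
case/andP=> _ _ /andP[wx nwx].
have tl : path D t (rcons l w).
  by move: cyc => /= /and4P[_ _ _]; rewrite rcons_path => /andP[].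
have inc s : s \in [:: x, y, z, t & rcons l w] -> s \in V by rewrite cV.
have [[xV yV] [zV tV]] : (x \in V /\ y \in V) /\ (z \in V /\ t \in V).
  by rewrite !inc // !inE eqxx ?orbT.
have fxy := alt x y xV yV nxy; have fyz := alt y z yV zV nyz.
have fzt := alt z t zV tV nzt.
have uzt : z \notin t :: rcons l w by case/and4P: uc.
have uyt : y \notin t :: rcons l w by case/and3P: uc => _; rewrite inE negb_or => /andP[].
have mem4 s : s \in V -> [|| s == x, s == y, s == z | s \in t :: rcons l w].
  by rewrite -cV !in_cons.
have wzn : w != z.
  by apply: contraNneq uzt => <-; rewrite inE mem_rcons mem_head orbT.
have tyn : t != y.
  by apply: contraNneq uyt => <-; rewrite mem_head.
(* The cycle reads [x], [y], [z], [t], ..., [w], and vertices two steps apart lie in the same class.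
   If [z] dominates [w], moving [z] into the path from [t] to [w] gives a path from [t] to [y]. *)
case: (boolP (D w z)) => [wz|]; last first.
  rewrite -(tourN tD wzn) => zw.
  have [p ptl pz] : exists2 p, p \in t :: l & D p z.
    apply/hasP; apply: contraT => /hasPn none.
    (* By [flip], exactly one of [u] and [v] dominates [z], namely [tip u v (D u z)]. *)
    suff /card_sub3_lt : [set s | D s z] \subset [set tip u v (D u z); x; y].
      by rewrite ltnNge (proj2 (proj2 regD z)).
    apply/subsetP=> s; rewrite !inE => sz.
    case: (boolP (s \in V)) => [sV|].
      case/or4P: (mem4 s sV) => [->|->|/eqP sz'|]; rewrite ?orbT //.
        by rewrite sz' tour_irr in sz.
      rewrite -rcons_cons mem_rcons inE => /orP[/eqP sw|/none]; last by rewrite sz.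
      by rewrite sw (tour_asym tD zw) in sz.
    rewrite inV negb_and !negbK => /orP[] /eqP se.
      by move: sz; rewrite se => ->; rewrite eqxx.
    by move: sz; rewrite se flip // => /negbTE->; rewrite eqxx.
  have [p' pp' pth] := path_insert_last tD uzt tl zw (introT hasP (ex_intro2 _ _ p ptl pz)).
  apply: (fin2 t (rcons (rcons p' w) x) y); last by rewrite fzt fyz negbK.
    apply/permP=> P; have /permP/(_ P) := pp'.
    by rewrite /= -!cats1 !count_cat /=; clear; lia.
  by rewrite 2!rcons_path pth !last_rcons wx xy.
(* Here [w] dominates [z], so if [y] dominates [t], moving [z] to the end gives a path from [x] to
   [z]. *)
case: (boolP (D y t)) => [yt|].
  apply: (fin2 x [:: y, t & rcons l w] z); last by rewrite fyz fxy negbK.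
    apply/permP=> P; by rewrite /= -!cats1 !count_cat /=; clear; lia.
  by rewrite rcons_path /= xy yt tl last_rcons.
rewrite -(tourN tD) 1?eq_sym // => ty.
(* Now [t] dominates [y]; moving [y] into the path from [t] to [w] gives a path from [z] to [x]. *)
have [q qtl yq] : exists2 q, q \in rcons l w & D y q.
  apply/hasP; apply: contraT => /hasPn none.
  suff /card_sub3_lt : [set s | D y s] \subset [set u; v; z].
    by rewrite ltnNge (proj1 (proj2 regD y)).
  apply/subsetP=> s; rewrite !inE => ys.
  case: (boolP (s \in V)) => [sV|]; last by rewrite inV negb_and !negbK => ->.
  case/or4P: (mem4 s sV) => [/eqP sx|/eqP sy|->|]; rewrite ?orbT //.
  - by rewrite sx (tour_asym tD xy) in ys.
  - by rewrite sy tour_irr in ys.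
  by rewrite inE => /orP[/eqP st|/none]; [rewrite st (tour_asym tD ty) in ys | rewrite ys].
have [p' pp' pth] := path_insert_head tD uyt tl ty (introT hasP (ex_intro2 _ _ q qtl yq)).
apply: (fin2 z (t :: rcons p' w) x); last by rewrite fyz fxy negbK.
  apply/permP=> P; have /permP/(_ P) := pp'.
  by rewrite /= -!cats1 !count_cat /=; clear; lia.
by rewrite rcons_path /= zt pth last_rcons.
Qed.

End SpanningStrand.

Theorem theorem4p3 (k t : nat) (T : finType) (D : rel T) :
  2 <= t ->
  is_tournament D ->
  irregularity D <= k ->
  6 * t + 5 * k - 3 <= #|T| ->
  forall w : nat, 1 <= w <= t.+1 -> k_weakly_connected D w.
Proof.
move=> t2 tD irr nT w /andP[w1 wt] u v uv.
have regD := irregularity_near_regular tD irr.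
have [w_le1|w_gt1] := leqP w 1.
  have nT' : 5 * k + 9 <= #|T| by lia.
  have [d [p [p0 up pV pth]]] := ex_spanning_strand regD uv nT'.
  have -> : w = size [:: (d, p)] by apply/eqP; rewrite eqn_leq w_le1.
  exists (map (strand_path u v) [:: (d, p)]); apply: linkage_container => //.
    rewrite /linkage /= /strand p0 pth /inner /= cats0 up inE negb_or uv !pV !inV.
    by rewrite !eqxx andbF.
  move=> x; rewrite /inner /= cats0 !in_cons pV inV.
  by case: (x == u); case: (x == v).
have [L [linkL szL bothL]] := ex_initial_linkage regD uv t2 nT.
(* Trimming precedes spanning, since dropping strands of a spanning linkage would uncover
   vertices. *)
have [|L1 [link1 sz1 both1]] := linkage_trim linkL bothL (w := w).
  by rewrite w_gt1; apply: leq_trans szL.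
have [|L2 [link2 sz2 span2]] := linkage_span regD _ uv link1 both1; first by lia.
exists (map (strand_path u v) L2); rewrite -sz1 -sz2; apply: linkage_container => //.
by rewrite -size_eq0 sz2 sz1; case: (w) w1.
Qed.
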